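(* Let $H$ be the complete $k$-uniform hypergraph on the vertex set $\{1,\dots,n\}$. Then $$\dim HC_{n-k-1}(\Delta(H))=\binom{n}{n-k}.$$
   Context: All vector spaces are over a fixed field of characteristic zero. A hypergraph $H=(V,E)$ consists of a vertex set $V=\{1,\dots,n\}$ and a set $E$ of subsets of $V$ (hyperedges). It is complete $k$-uniform if its hyperedges are exactly the $k$-element subsets of $V$. For $r\ge -1$ consider ordered set partitions $(B_1,\dots,B_{r+2})$ of $\{1,\dots,n\}$ into nonempty blocks, at least one of which contains a hyperedge of $H$, modulo the signed cyclic relation $(B_1,\dots,B_{r+2})\sim(-1)^{r+1}(B_{\sigma(1)},\dots,B_{\sigma(r+2)})$, where $\sigma=(1,2,\dots,r+2)$ is the cyclic permutation. The class is written $[B_1,\dots,B_{r+2}]$ and is represented by the unique representative with $1\in B_1$. Let $C_r$ be the vector space with basis these classes $[B_1,\dots,B_{r+2}]$ with $1\in B_1$, and let $$\partial_r([B_1,\dots,B_{r+2}])=\sum_{i=1}^{r+1}(-1)^{i+1}[B_1,\dots,B_i\cup B_{i+1},\dots,B_{r+2}]+(-1)^{r+3}[B_1\cup B_{r+2},B_2,\dots,B_{r+1}]$$ for $r\ge 0$, and $\partial_{-1}=0$. The cyclic coloring complex $\Delta(H)$ is the chain complex $(C_r,\partial_r)$, and $HC_r(\Delta(H))=\ker\partial_r/\operatorname{im}\partial_{r+1}$.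
   Formalization: The formal theorem assumes 3 ≤ k ≤ n: the formula fails for k = 1, n = 2 (dimension at most 1, not 2) and for k = 2, n = 4 (dimension 8, not 6), and k ≤ n makes the degree n−k−1 at least −1. *)

(* Defs.v *)
(* MathComp. *)
From HB Require Import structures.
From mathcomp Require Export all_boot all_order all_algebra.

Set Implicit Arguments.
Unset Strict Implicit.
Unset Printing Implicit Defensive.

Import GRing.Theory.
Local Open Scope ring_scope.

(* Vertices are 'I_n, so the vertex called 1 on paper is the ordinal of value
   0. *)
Definition hypergraph (n : nat) := {set {set 'I_n}}.

Definition complete_uniform (n k : nat) : hypergraph n :=
  [set A : {set 'I_n} | #|A| == k].

Section CyclicColoringComplex.

Variables (F : fieldType) (n : nat) (H : hypergraph n).

Definition ordered_partition (s : seq {set 'I_n}) : bool :=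
  uniq s && partition [set B in s] [set: 'I_n].

(* The normal form of a class modulo the signed cyclic relation: the unique
   representative whose first block contains vertex 1. *)
Definition normal_class (s : seq {set 'I_n}) : bool :=
  [&& ordered_partition s,
      has (fun B : {set 'I_n} => [exists A in H, A \subset B]) s
    & [exists v in nth set0 s 0, val v == 0%N]].

(* Indexed by the number b = r + 2 of blocks. *)
Definition cell (b : nat) := {s : b.-tuple {set 'I_n} | normal_class s}.

Definition chain (b : nat) := {ffun cell b -> F^o}.

(* The basis vector [B_1, ..., B_b]; it is zero when s is not a normal form
   with b blocks.  Every term of the boundary of a normal form with at least
   two blocks is again a normal form, so that this default only serves to make
   the boundary vanish on classes with one block (chain 0 is the zero space). *)
Definition bracket (b : nat) (s : seq {set 'I_n}) : chain b :=
  [ffun c : cell b => (tval (val c) == s)%:R].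

Definition merge_at (i : nat) (s : seq {set 'I_n}) : seq {set 'I_n} :=
  take i s ++ (nth set0 s i :|: nth set0 s i.+1) :: drop i.+2 s.

Definition merge_ends (s : seq {set 'I_n}) : seq {set 'I_n} :=
  (nth set0 s 0 :|: last set0 s) :: behead (take (size s).-1 s).

(* With m = r + 1, the boundary of a class with m.+1 = r + 2 blocks.  The index
   i is the paper's i minus 1, whence the sign (-1)^(i + 2), and
   r + 3 = m + 2. *)
Definition bracket_boundary (m : nat) (s : seq {set 'I_n}) : chain m :=
  \sum_(i < m) (-1) ^+ i.+2 *: bracket m (merge_at i s)
  + (-1) ^+ m.+2 *: bracket m (merge_ends s).

Definition boundary_fun (m : nat) (f : chain m.+1) : chain m :=
  \sum_(c : cell m.+1) f c *: bracket_boundary m (tval (val c)).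

Fact boundary_fun_is_linear (m : nat) : linear (@boundary_fun m).
Proof.
move=> a f g; rewrite /boundary_fun scaler_sumr -big_split /=.
by apply: eq_bigr => c _; rewrite !ffunE scalerDl scalerA.
Qed.

HB.instance Definition _ (m : nat) :=
  GRing.isLinear.Build F (chain m.+1) (chain m) *:%R (@boundary_fun m)
    (@boundary_fun_is_linear m).

Definition boundary (m : nat) : 'Hom(chain m.+1, chain m) :=
  linfun (@boundary_fun m).

(* MathComp has no quotient of vector spaces: ker d / im d' is realized as a
   complement of im d' in ker d (im d' is contained in ker d). *)
Definition homology (m : nat) : {vspace chain m.+1} :=
  (lker (boundary m) :\: limg (boundary m.+1))%VS.

(* dim HC_r; the complex is zero in degrees r < -1. *)
Definition dimHC (r : int) : nat :=
  if (r + 1)%R is Posz m then \dim (homology m) else 0%N.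

End CyclicColoringComplex.

(* Main.v *)
(* The chains of degree n - k - 1 are spanned by the classes with n - k + 1
   blocks, namely one block A of size k and singletons; there are no chains in
   higher degree, so the homology is the kernel of the boundary.  Since k >= 3,
   a block of size 2 in a face can only come from merging two singletons, in
   either order.  Vanishing of the coefficients of such faces says that a cycle
   is antisymmetric under exchanging cyclically adjacent singletons, so that it
   is determined by one scalar for each A.  Conversely, the sum of all cyclic
   orders of A and the singletons outside A, weighted by the inversion sign of
   the list of blocks, is a cycle.  Hence the kernel has a basis indexed by the
   k-subsets A. *)
From HB Require Import structures.
Require Import Defs.
From mathcomp Require Import zify.

Set Implicit Arguments.
Unset Strict Implicit.
Unset Printing Implicit Defensive.

Import GRing.Theory.
Local Open Scope ring_scope.

(** * Parity of the inversions of a list *)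

Section InversionSign.

Variable T : finType.
Implicit Types (x y : T) (s p q : seq T).

(** The order given by [enum_rank] is arbitrary; it gives every ordering of a set of blocks a sign
    without fixing a reference ordering. *)
Fixpoint odd_inversions s : bool :=
  if s is x :: s' then
    odd (count (fun y => enum_rank y < enum_rank x)%N s') (+) odd_inversions s'
  else false.

(** Only the exchanged pair changes its status, and exactly one of its two orders is an
    inversion. *)
Lemma odd_inversions_swap p x y q : x != y ->
  odd_inversions (p ++ y :: x :: q) = ~~ odd_inversions (p ++ x :: y :: q).
Proof.
move=> neq_xy; elim: p => [|z p IHp] /=.
  have : (enum_rank x < enum_rank y)%N (+) (enum_rank y < enum_rank x)%N.
    have : enum_rank x != enum_rank y by rewrite (inj_eq enum_rank_inj).
    by rewrite -val_eqE /=; case: ltngtP.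
  rewrite !oddD !oddb; case: (_ < _)%N; case: (_ < _)%N => //= _;
  by move: (odd _) (odd _) (odd_inversions q) => [] [] [].
by rewrite IHp addbN !count_cat /=; congr (~~ (odd (_ + _) (+) _)); apply: addnCA.
Qed.

(** The entry [x] passes the entries of [q] one by one, each time by a swap of distinct neighbours.
    The prefix varies because the induction moves the head of [q] into it. *)
Lemma odd_inversions_rcons p q x : x \notin q ->
  odd_inversions (p ++ rcons q x) = odd (size q) (+) odd_inversions (p ++ x :: q).
Proof.
elim: q p => [|y q IHq] p //=; rewrite inE negb_or => /andP[neq_xy qx].
rewrite -cat_rcons IHq // cat_rcons [in LHS]odd_inversions_swap //.
by rewrite addbN addNb.
Qed.

End InversionSign.

(** * Ordered set partitions through incidence counts *)

Section OrderedPartitions.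

Variable n : nat.
Implicit Types (s p q : seq {set 'I_n}) (B x y : {set 'I_n}).

(** Counts are invariant under permuting blocks and easy to follow under a merge, so later arguments
    use this form. *)
Lemma ordered_partitionP s :
  reflect (set0 \notin s /\
           forall v, count (fun B : {set 'I_n} => v \in B) s = 1%N)
          (ordered_partition s).
Proof.
apply: (iffP andP) => [[Us /and3P[/eqP covs trs s0]] | [s0 cnt]].
  rewrite inE in s0; split=> // v.
  have: v \in cover [set B in s] by rewrite covs inE.
  case/bigcupP=> B; rewrite inE => sB Bv.
  rewrite (@eq_in_count _ _ (pred1 B)) => [|C sC /=].
    by rewrite count_uniq_mem // sB.
  have [->|neqCB] := eqVneq C B; first by [].
  have /trivIsetP/(_ C B) := trs; rewrite !inE => /(_ sC sB neqCB).
  by rewrite disjoint_sym => /disjointFr->.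
(* A nonempty block occurring twice would be counted twice at each of its vertices. *)
have Us : uniq s.
  apply: count_mem_uniq => B; case: (boolP (B \in s)) => sB; last first.
    by apply/eqP; rewrite -leqn0 leqNgt -has_count has_pred1.
  have /set0Pn[v Bv] : B != set0 by apply: contraNneq s0 => <-.
  apply/eqP; rewrite eqn_leq -has_count has_pred1 sB andbT.
  by rewrite -[leqRHS]/1%N -(cnt v) sub_count // => C /eqP->.
split=> //; apply/and3P; split.
- apply/eqP/setP=> v; rewrite inE; apply/bigcupP.
  have: has (fun B : {set 'I_n} => v \in B) s by rewrite has_count cnt.
  by case/hasP=> B sB Bv; exists B; rewrite ?inE.
- apply/trivIsetP=> B C; rewrite !inE => sB sC neqBC.
  rewrite -setI_eq0; apply/eqP/setP=> v; rewrite !inE; apply/negP=> /andP[Bv Cv].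
  have := cnt v; apply/eqP; rewrite neq_ltn; apply/orP; right.
  have le2 : (count (predU (pred1 B) (pred1 C)) s <=
              count (fun D : {set 'I_n} => v \in D) s)%N.
    by apply: sub_count => D /orP[]/eqP->.
  apply: leq_trans le2; have := count_predUI (pred1 B) (pred1 C) s.
  rewrite (@eq_count _ (predI _ _) pred0); last first.
    by move=> D /=; apply/negP=> /andP[/eqP-> /eqP]; apply/eqP.
  by rewrite count_pred0 addn0 => ->; rewrite !count_uniq_mem // sB sC.
- by rewrite inE.
Qed.

Lemma sum_card_ordered_partition s :
  ordered_partition s -> (\sum_(B <- s) #|B| = n)%N.
Proof.
case/ordered_partitionP=> _ cnt.
under eq_bigr do rewrite -sum1_card big_mkcond.
rewrite exchange_big /= -[RHS]card_ord -sum1_card; apply: eq_bigr => v _.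
by rewrite -big_mkcond sum1_count cnt.
Qed.

Lemma ordered_partition_card_gt0 s B :
  ordered_partition s -> B \in s -> (0 < #|B|)%N.
Proof.
case/ordered_partitionP=> s0 _ sB; rewrite card_gt0.
by apply: contraNneq s0 => <-.
Qed.

Lemma ordered_partition_perm s s' :
  perm_eq s s' -> ordered_partition s -> ordered_partition s'.
Proof.
move=> eqs /ordered_partitionP[s0 cnt]; apply/ordered_partitionP.
by split=> [|v]; rewrite -?(perm_mem eqs) // -(permP eqs).
Qed.

Lemma ordered_partition_merge p x y q :
  ordered_partition (p ++ x :: y :: q) -> ordered_partition (p ++ (x :|: y) :: q).
Proof.
case/ordered_partitionP=> s0 cnt; apply/ordered_partitionP; split=> [|v].
  move: s0; rewrite !mem_cat !inE !negb_or => /and4P[-> x0 _ ->].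
  rewrite andbT /=; apply: contraNneq x0 => /esym/eqP.
  by rewrite setU_eq0 => /andP[/eqP-> _].
have := cnt v; rewrite !count_cat /= !inE; lia.
Qed.

End OrderedPartitions.

(** * Normal forms under permutations and merges *)

Section NormalClasses.

Variables (n : nat) (H : hypergraph n).
Implicit Types (s p q : seq {set 'I_n}) (B x y : {set 'I_n}).

Lemma normal_class_perm B s s' :
  perm_eq s s' -> normal_class H (B :: s) -> normal_class H (B :: s').
Proof.
move=> eqs; have eqBs: perm_eq (B :: s) (B :: s') by rewrite perm_cons.
case/and3P=> ops hs /= Bv; apply/and3P; split=> //.
  exact: ordered_partition_perm ops.
by rewrite -(perm_has _ eqBs).
Qed.

Lemma normal_class_merge p x y q :
  normal_class H (p ++ x :: y :: q) -> normal_class H (p ++ (x :|: y) :: q).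
Proof.
case/and3P=> ops hs vs; apply/and3P; split.
- exact: ordered_partition_merge.
- have mono (z : {set _}) : z \subset x :|: y -> [exists A in H, A \subset z] ->
      [exists A in H, A \subset x :|: y].
    move=> zxy /exists_inP[A HA Az]; apply/exists_inP; exists A => //.
    exact: subset_trans Az zxy.
  move: hs; rewrite !has_cat /= => /or4P[-> // | /mono -> | /mono -> | ->];
  by rewrite ?subsetUl ?subsetUr ?orbT.
- case: p vs {ops hs} => //= /exists_inP[v xv v0].
  by apply/exists_inP; exists v; rewrite ?inE ?xv.
Qed.

(** Both heads contain the vertex of value 0, which lies in only one of the common blocks. *)
Lemma head_normal_class_inj s s' : perm_eq s s' ->
  normal_class H s -> normal_class H s' -> nth set0 s 0 = nth set0 s' 0.
Proof.
move=> eqs /and3P[ops _ /exists_inP[v sv /eqP v0]].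
move=> /and3P[_ _ /exists_inP[w sw /eqP w0]].
have eq_vw : v = w by apply: val_inj; rewrite /= v0 w0.
rewrite -eq_vw in sw.
case: s s' eqs ops sv sw => [|B s] [|C s'] //=; rewrite ?inE //.
move=> eqs /ordered_partitionP[_ /(_ v) /= cnt] Bv Cv.
apply/esym/eqP; apply: contraT => neqCB.
have: C \in B :: s by rewrite (perm_mem eqs) mem_head.
rewrite inE (negPf neqCB) /= => sC.
have: (0 < count (fun D : {set 'I_n} => v \in D) s)%N.
  by rewrite -has_count; apply/hasP; exists C.
by move: cnt; rewrite Bv add1n => -[->].
Qed.

End NormalClasses.

(** Applied to the sizes of all blocks but one containing a hyperedge: it bounds the number of
    blocks, and equality forces singletons. *)
Lemma all_eq1_leq_sum (I : eqType) (r : seq I) (f : I -> nat) :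
  {in r, forall i, 0 < f i}%N ->
  (size r <= \sum_(i <- r) f i)%N /\
  ((\sum_(i <- r) f i <= size r)%N -> {in r, forall i, f i = 1%N}).
Proof.
elim: r => [|i r IHr] f_gt0; first by rewrite big_nil.
have /IHr[ge_r eq_r] : {in r, forall j, 0 < f j}%N.
  by move=> j rj; apply: f_gt0; rewrite inE rj orbT.
have fi := f_gt0 i (mem_head i r).
rewrite big_cons /=; split=> [|le_r j]; first by lia.
rewrite inE => /predU1P[->|]; first by lia.
by apply: eq_r; lia.
Qed.

(** * Classes with the largest number of blocks *)

Section TopCells.

Variables (n k : nat).
Local Notation H := (complete_uniform n k).
Implicit Types (s p q : seq {set 'I_n}) (A B x y : {set 'I_n}).

Lemma has_complete_uniform s :
  has (fun B : {set 'I_n} => [exists A in H, A \subset B]) s ->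
  exists s1 A s2, s = s1 ++ A :: s2 /\ (k <= #|A|)%N.
Proof.
case/hasP=> A sA /exists_inP[C]; rewrite inE => /eqP <- CA.
case/splitPr: sA => s1 s2; exists s1, A, s2; split=> //.
exact: subset_leq_card.
Qed.

(** Some block has at least [k] elements and every other block at least one. *)
Lemma size_normal_class s : normal_class H s -> (size s + k <= n.+1)%N.
Proof.
case/and3P=> ops hs _; have card_s := sum_card_ordered_partition ops.
have [s1 [A [s2 [def_s leA]]]] := has_complete_uniform hs.
have [] := @all_eq1_leq_sum _ (s1 ++ s2) (fun B : {set 'I_n} => #|B|).
  move=> B sB; apply: (ordered_partition_card_gt0 ops).
  by move: sB; rewrite def_s !mem_cat inE => /orP[]->; rewrite ?orbT.
move: card_s; rewrite def_s !big_cat big_cons !size_cat /=.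
move: (\sum_(_ <- s1) _)%N (\sum_(_ <- s2) _)%N => a b card_s ge_s _.
by move: (#|A|) leA card_s => c; lia.
Qed.

(* Classes with n - k + 1 blocks, the largest possible number. *)
Definition top s := normal_class H s && (n.+1 == size s + k)%N.

(** The equality case of [size_normal_class]: no block can exceed its minimal size. *)
Lemma topP s : top s ->
  exists s1 A s2, [/\ s = s1 ++ A :: s2, #|A| = k
                    & {in s1 ++ s2, forall B, #|B| = 1%N}].
Proof.
case/andP=> /and3P[ops hs _] /eqP sz.
have card_s := sum_card_ordered_partition ops.
have [s1 [A [s2 [def_s leA]]]] := has_complete_uniform hs.
have [] := @all_eq1_leq_sum _ (s1 ++ s2) (fun B : {set 'I_n} => #|B|).
  move=> B sB; apply: (ordered_partition_card_gt0 ops).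
  by move: sB; rewrite def_s !mem_cat inE => /orP[]->; rewrite ?orbT.
move=> ge_s eq_s; exists s1, A, s2; move: card_s ge_s eq_s sz.
rewrite def_s !big_cat big_cons !size_cat /=.
move: (\sum_(_ <- s1) _)%N (\sum_(_ <- s2) _)%N => a b card_s ge_s eq_s sz.
split=> //; last apply: eq_s; by move: (#|A|) leA card_s => c; lia.
Qed.

Lemma top_card s B : top s -> B \in s -> #|B| = 1%N \/ #|B| = k.
Proof.
case/topP=> s1 [A [s2 [-> cA c1]]]; rewrite mem_cat inE orbCA => /predU1P[->|sB].
  by right.
by left; apply: c1; rewrite mem_cat.
Qed.

Lemma top_perm B s s' : perm_eq s s' -> top (B :: s) -> top (B :: s').
Proof.
move=> eqs /andP[nBs /eqP sz]; rewrite /top (normal_class_perm eqs nBs).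
by rewrite sz /= (perm_size eqs) eqxx.
Qed.

(** The blocks other than [A] are the singletons of its complement, so [A] determines the list of
    blocks up to order. *)
Lemma top_perm_eq A s s' : (1 < k)%N -> #|A| = k -> A \in s -> A \in s' ->
  top s -> top s' -> perm_eq s s'.
Proof.
move=> k_gt1 cA.
wlog suff sub : s s' / A \in s -> A \in s' -> top s -> top s' -> {subset s <= s'}.
  move=> sA s'A ts ts'; apply: uniq_perm.
  - by case/andP: ts => /and3P[/andP[]].
  - by case/andP: ts' => /and3P[/andP[]].
  - by move=> B; apply/idP/idP; apply: sub.
move=> sA s'A ts ts' B sB.
case/andP: (ts) => /and3P[ops _ _] _; case/andP: (ts') => /and3P[ops' _ _] _.
have [-> // | neqBA] := eqVneq B A.
have card1 (r : seq {set 'I_n}) C :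
    A \in r -> top r -> C \in r -> C != A -> #|C| = 1%N.
  move=> rA /topP[s1 [D [s2 [def_r cD c1]]]].
  have eqAD : A = D.
    apply/eqP; apply: contraT => neqAD; have := c1 A.
    move: rA; rewrite def_r !mem_cat inE (negPf neqAD) /= => rA /(_ rA).
    by rewrite cA => k1; rewrite k1 in k_gt1.
  move=> rC neqCA; apply: c1.
  by move: rC; rewrite def_r !mem_cat inE -eqAD (negPf neqCA).
have /eqP/cards1P[v defB] := card1 _ _ sA ts sB neqBA.
have vA : v \notin A.
  apply/negP=> Av; case/ordered_partitionP: ops => _ /(_ v) cnt.
  have : (2 <= count (fun D : {set 'I_n} => v \in D) s)%N.
    case/splitPr: sA sB cnt => s1 s2; rewrite mem_cat inE (negPf neqBA) /=.
    rewrite -mem_cat -/(count _ _) => sB _.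
    rewrite count_cat /= Av addnCA -count_cat ltnS -has_count.
    by apply/hasP; exists B; rewrite // defB inE.
  by rewrite cnt.
case/ordered_partitionP: ops' => _ /(_ v) cnt.
have: has (fun D : {set 'I_n} => v \in D) s' by rewrite has_count cnt.
case/hasP=> C s'C Cv; suff -> : B = C by [].
have neqCA : C != A by apply: contraNneq vA => <-.
have /eqP/cards1P[w defC] := card1 _ _ s'A ts' s'C neqCA.
by move: Cv; rewrite defB defC inE => /eqP->.
Qed.

(** List [A] and the singletons outside it, then rotate until the block containing the vertex of
    value 0 comes first. *)
Lemma exists_top A : (0 < k)%N -> #|A| = k -> exists2 s, top s & A \in s.
Proof.
move=> k_gt0 cA; pose s := A :: [seq [set v] | v <- enum (~: A)].
have ops : ordered_partition s.
  apply/ordered_partitionP; split=> [|v].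
    rewrite inE negb_or eq_sym -card_gt0 cA k_gt0 /=.
    by apply/mapP=> -[v _ /esym/eqP]; rewrite -cards_eq0 cards1.
  rewrite /= count_map (@eq_count _ _ (pred1 v)); last first.
    by move=> w; rewrite /= inE eq_sym.
  by rewrite count_uniq_mem ?enum_uniq // mem_enum inE; case: (v \in A).
have n_gt0 : (0 < n)%N.
  rewrite -cA in k_gt0; apply: leq_trans k_gt0 _.
  by rewrite -[n in (_ <= n)%N]card_ord max_card.
pose v0 := Ordinal n_gt0.
have: has (fun D : {set 'I_n} => v0 \in D) s.
  by case/ordered_partitionP: ops => _ /(_ v0) cnt; rewrite has_count cnt.
case/hasP=> B sB Bv0; have [i s' rot_s] := rot_to sB.
have eqs : perm_eq s (B :: s') by rewrite -rot_s perm_sym perm_rot.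
exists (B :: s'); last by rewrite -(perm_mem eqs) mem_head.
apply/andP; split; last first.
  rewrite -(perm_size eqs) /= size_map -cardE.
  by have := cardsC A; rewrite card_ord cA addSn addnC => ->.
apply/and3P; split; first exact: ordered_partition_perm ops.
  apply/hasP; exists A; first by rewrite -(perm_mem eqs) mem_head.
  by apply/exists_inP; exists A; rewrite ?inE ?cA.
by apply/exists_inP; exists v0.
Qed.

End TopCells.

(** * Faces that contain a merged pair of singletons *)

Section Merging.

Variable n : nat.
Implicit Types (s p q : seq {set 'I_n}) (x y z : {set 'I_n}).

Lemma merge_at_cat p x y q :
  merge_at (size p) (p ++ x :: y :: q) = p ++ (x :|: y) :: q.
Proof.
rewrite /merge_at take_size_cat // !nth_cat ltnn subnn ltnNge leqnSn /=.
by rewrite subSnn drop_cat ltnNge -addn2 leq_addr /= addKn /= drop0.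
Qed.

Lemma merge_ends_rcons x q y : merge_ends (x :: rcons q y) = (x :|: y) :: q.
Proof.
by rewrite /merge_ends /= last_rcons size_rcons /= -cats1 take_size_cat.
Qed.

Lemma cat_adjacent i s : (i.+1 < size s)%N ->
  exists p x y q, s = p ++ x :: y :: q /\ size p = i.
Proof.
move=> lt_is; exists (take i s), (nth set0 s i), (nth set0 s i.+1), (drop i.+2 s).
rewrite -!drop_nth ?cat_take_drop ?size_takel //; lia.
Qed.

Lemma ordered_partition_adjacent p x y q : ordered_partition (p ++ x :: y :: q) ->
  [/\ x != set0, y != set0 & [disjoint x & y]].
Proof.
case/ordered_partitionP=> s0 cnt; split.
- by apply: contraNneq s0 => ->; rewrite mem_cat mem_head orbT.
- by apply: contraNneq s0 => ->; rewrite mem_cat !inE eqxx !orbT.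
rewrite -setI_eq0; apply/eqP/setP=> v; rewrite !inE; apply/negP=> /andP[xv yv].
by have := cnt v; rewrite count_cat /= xv yv; lia.
Qed.

Lemma setU_eq_set2 x y (a b : 'I_n) : x != set0 -> y != set0 ->
  [disjoint x & y] -> x :|: y = [set a] :|: [set b] ->
  x = [set a] /\ y = [set b] \/ x = [set b] /\ y = [set a].
Proof.
move=> x0 y0 dis_xy eq_ab.
have sub1 (z : {set 'I_n}) c : z != set0 -> z \subset [set c] -> z = [set c].
  by move=> z0; rewrite subset1 (negPf z0) orbF => /eqP.
(* If [a] lies in [y], then [b] lies in [x], and [a] and [b] exchange roles. *)
wlog xa : a b eq_ab / a \in x => [IH|].
  have: a \in x :|: y by rewrite eq_ab !inE eqxx.
  rewrite inE => /orP[|ya]; first exact: IH.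
  have xb: b \in x.
    apply: contraT => xb; case/set0Pn: x0 => v xv.
    have: v \in x :|: y by rewrite inE xv.
    rewrite eq_ab !inE => /orP[]/eqP def_v; rewrite def_v in xv.
      by rewrite (disjointFr dis_xy xv) in ya.
    by rewrite xv in xb.
  have eq_ba : x :|: y = [set b] :|: [set a] by rewrite eq_ab setUC.
  by have [] := IH b a eq_ba xb; [right | left].
left; have ya := disjointFr dis_xy xa.
have def_y : y = [set b].
  apply: sub1 => //; apply/subsetP=> v yv.
  have: v \in x :|: y by rewrite inE yv orbT.
  rewrite eq_ab !inE => /orP[]/eqP def_v; last by rewrite def_v.
  by rewrite -def_v yv in ya.
split=> //; apply: sub1 => //; apply/subsetP=> v xv.
have: v \in x :|: y by rewrite inE xv.
rewrite eq_ab !inE => /orP[]// /eqP def_v.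
by have := disjointFr dis_xy xv; rewrite def_y inE def_v eqxx.
Qed.

(** Away from the merged position, an entry of a face is already a block of the class; this locates
    the merge below. *)
Lemma nth_cat_mem p x q (i : nat) : i != size p -> (i < size p + (size q).+1)%N ->
  nth set0 (p ++ x :: q) i \in p ++ q.
Proof.
move=> neq_ip lt_i; rewrite nth_cat mem_cat; case: ltnP => [lt_ip | le_pi].
  by rewrite mem_nth.
have [j def_i] : exists j, i = (size p + j.+1)%N by exists (i - size p).-1; lia.
move: lt_i; rewrite def_i addKn ltn_add2l ltnS /= => lt_j.
by apply/orP; right; apply: mem_nth.
Qed.

Section Top.

Variable k : nat.
Hypothesis k_gt2 : (2 < k)%N.
Local Notation top := (@top n k).

Lemma top_set2_notin s (a b : 'I_n) :
  a != b -> top s -> [set a] :|: [set b] \notin s.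
Proof.
move=> neq_ab ts; apply/negP=> /(top_card ts).
by rewrite cards2 neq_ab; move: k_gt2; lia.
Qed.

Lemma top_ordered_partition s : top s -> ordered_partition s.
Proof. by case/andP=> /and3P[]. Qed.

Lemma neq_adjacent p a b q : ordered_partition (p ++ [set a] :: [set b] :: q) ->
  a != b.
Proof.
case/ordered_partition_adjacent=> _ _; rewrite disjoints1 inE //.
Qed.

(** A top class has no block of size two, so the pair in the face sits exactly where the merge took
    place. *)
Lemma merge_at_singletons p a b q c j :
    top (p ++ [set a] :: [set b] :: q) -> top c -> (j.+1 < size c)%N ->
    merge_at j c = p ++ ([set a] :|: [set b]) :: q ->
  j = size p /\ (c = p ++ [set a] :: [set b] :: q \/
                 c = p ++ [set b] :: [set a] :: q).
Proof.
move=> ts tc /cat_adjacent[c1 [x [y [c2 [def_c <-]]]]] {j}.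
have neq_ab := neq_adjacent (top_ordered_partition ts).
rewrite def_c merge_at_cat => eq_m.
have sz : size c1 = size p.
  apply/esym/eqP; apply: contraT => neq_sz.
  have /(nth_cat_mem (x :|: y)) := neq_sz => /(_ c2).
  have /= := congr1 size eq_m; rewrite !size_cat /= => ->.
  rewrite eq_m nth_cat ltnn subnn /= addnS ltnS leq_addr => /(_ isT).
  move=> c12; case/negP: (top_set2_notin neq_ab tc).
  by move: c12; rewrite def_c !mem_cat !inE => /orP[]->; rewrite ?orbT.
split=> //; move/eqP: eq_m; rewrite eqseq_cat // => /andP[/eqP-> /eqP[exy ->]].
have := top_ordered_partition tc; rewrite def_c.
case/ordered_partition_adjacent=> x0 y0 dis.
by have [[-> ->]|[-> ->]] := setU_eq_set2 x0 y0 dis exy; [left | right].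
Qed.

(** Merging the ends puts the new block first; with [p] nonempty the pair would already be a block
    of [c]. *)
Lemma merge_ends_singletons p a b q c :
    top (p ++ [set a] :: [set b] :: q) -> top c -> (1 < size c)%N ->
    merge_ends c = p ++ ([set a] :|: [set b]) :: q ->
  p = [::] /\ (c = [set a] :: rcons q [set b] \/ c = [set b] :: rcons q [set a]).
Proof.
move=> ts tc; have neq_ab := neq_adjacent (top_ordered_partition ts).
case: c tc => [|x c] //; case/lastP: c => [|c y] // tc _.
rewrite merge_ends_rcons; case: p ts => [|z p] ts [].
  move=> exy ->; split=> //.
  have: ordered_partition ([::] ++ x :: y :: c).
    apply: ordered_partition_perm (top_ordered_partition tc).
    by rewrite perm_cons perm_rcons.
  case/ordered_partition_adjacent=> x0 y0 dis.
  by have [[-> ->]|[-> ->]] := setU_eq_set2 x0 y0 dis exy; [left | right].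
move=> _ def_c; case/negP: (top_set2_notin neq_ab tc).
by rewrite def_c inE mem_rcons !inE mem_cat mem_head !orbT.
Qed.

Lemma top_head_inj a b p q : perm_eq ([set a] :: p) ([set b] :: q) ->
  top ([set a] :: p) -> top ([set b] :: q) -> a = b.
Proof.
move=> eqs /andP[nA _] /andP[nB _]; have /= := head_normal_class_inj eqs nA nB.
by move/setP/(_ a); rewrite !inE eqxx => /esym/eqP.
Qed.

End Top.

End Merging.

(** * Coefficients of chains and of their boundaries *)

Section Incidence.

Variables (F : fieldType) (n : nat) (H : hypergraph n).

(** The coefficient of the face [t] in the boundary of [s], with the exponents of [bracket_boundary]
    lowered by two. *)
Definition incidence (b : nat) (t s : seq {set 'I_n}) : F :=
  \sum_(i < b) (-1) ^+ i * (t == merge_at i s)%:R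
  + (-1) ^+ b * (t == merge_ends s)%:R.

Lemma boundary_funE b (f : chain F H b.+1) t :
  boundary_fun f t =
    \sum_(c : cell H b.+1) f c * incidence b (tval (val t)) (tval (val c)).
Proof.
rewrite /boundary_fun sum_ffunE; apply: eq_bigr => c _.
rewrite !ffunE sum_ffunE; congr (_ * (_ + _)); last first.
  by rewrite !exprS !mulN1r opprK.
by apply: eq_bigr => i _; rewrite !ffunE !exprS !mulN1r opprK.
Qed.

Definition mkcell b s (ns : normal_class H s) (sz : size s == b) : cell H b :=
  exist _ (Tuple sz) ns.

(** There are finitely many cells, so an injective map from cells to cells permutes them. *)
Lemma sum_cell_reindex b (g : seq {set 'I_n} -> seq {set 'I_n})
    (G : seq {set 'I_n} -> F) :
    (forall c : cell H b, normal_class H (g (tval (val c)))) ->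
    (forall c : cell H b, size (g (tval (val c))) == b) ->
    (forall c c' : cell H b,
      g (tval (val c)) = g (tval (val c')) -> tval (val c) = tval (val c')) ->
  \sum_(c : cell H b) G (g (tval (val c))) = \sum_(c : cell H b) G (tval (val c)).
Proof.
move=> ng sg injg; pose h c := mkcell (ng c) (sg c).
rewrite [RHS](reindex_inj (h := h)) // => c c' eq_h.
do 2 apply: val_inj; apply: injg.
exact: (congr1 (fun d : cell H b => tval (val d)) eq_h).
Qed.

(* coef f extends f by 0 to lists of blocks that are not cells. *)
Definition coef b (f : chain F H b) (s : seq {set 'I_n}) : F :=
  \sum_(c : cell H b) f c * (tval (val c) == s)%:R.

Lemma coef_cell b (f : chain F H b) c : coef f (tval (val c)) = f c.
Proof.
rewrite /coef (bigD1 c) //= eqxx mulr1 big1 ?addr0 // => c' neq_c.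
by rewrite !val_eqE (negPf neq_c) mulr0.
Qed.

(** Meant for faces that arise from at most two cells, with relative sign [e]. *)
Lemma sum_coef2 b (f : chain F H b) (G : seq {set 'I_n} -> F) e s s' :
  (forall c : cell H b, G (tval (val c)) =
     (tval (val c) == s)%:R + e * (tval (val c) == s')%:R) ->
  \sum_(c : cell H b) f c * G (tval (val c)) = coef f s + e * coef f s'.
Proof.
move=> GE; rewrite /coef mulr_sumr -big_split; apply: eq_bigr => c _ /=.
by rewrite GE mulrDr mulrCA.
Qed.

End Incidence.

(** * Rigidity of cycles with the largest number of blocks *)

Section Kernel.

Variables (F : fieldType) (n k m : nat).
Local Notation H := (complete_uniform n k).
Hypotheses (k_gt2 : (2 < k)%N) (def_n : n = (m + k)%N).
Implicit Types (s p q v w : seq {set 'I_n}) (x y A B : {set 'I_n}).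
Local Notation top := (@top n k).

Lemma top_cell (c : cell H m.+1) : top (tval (val c)).
Proof. by rewrite /top (valP c) size_tuple addSn -def_n eqxx. Qed.

Lemma size_top s : top s -> size s = m.+1.
Proof. by case/andP=> _ /eqP; move: (size s) => z; lia. Qed.

Section Moves.

Variable f : chain F H m.+1.
Hypothesis f_ker : boundary_fun f = 0.

Lemma sum_incidence0 t : normal_class H t -> size t == m ->
  \sum_(c : cell H m.+1) f c * incidence F m t (tval (val c)) = 0.
Proof.
by move=> nt st; rewrite -(boundary_funE f (mkcell nt st)) f_ker ffunE.
Qed.

(** The face that merges the two singletons comes only from their two orders, both times at position
    [size p] and with the same sign. *)
Lemma coef_swap p (a b : 'I_n) q : p != [::] ->
    top (p ++ [set a] :: [set b] :: q) ->
  coef f (p ++ [set b] :: [set a] :: q) =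
  - coef f (p ++ [set a] :: [set b] :: q).
Proof.
move=> p0 ts; have sz_s := size_top ts; have ops := top_ordered_partition ts.
have sz_p : (size p < m)%N.
  by move: sz_s; rewrite size_cat /= !addnS => -[<-]; rewrite ltnS leq_addr.
case/andP: (ts) => ns _; have nt := normal_class_merge ns.
have st : size (p ++ ([set a] :|: [set b]) :: q) == m.
  by move: sz_s; rewrite !size_cat /= !addnS => -[<-].
have neq_ab := neq_adjacent ops.
(* The common sign of both incidences; its square, inserted below, normalises them to 1. *)
pose e : F := (-1) ^+ size p.
have := sum_incidence0 nt st.
under eq_bigr => c _.
  rewrite -[incidence _ _ _ _]mul1r -(sqrr_sign F (size p)) expr2 -mulrA mulrCA.
  over.
set t := p ++ _ :: q.
rewrite -mulr_sumr (@sum_coef2 _ _ _ _ f (fun s => e * incidence F m t s) 1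
   (p ++ [set a] :: [set b] :: q)
   (p ++ [set b] :: [set a] :: q)).
- rewrite mul1r => /eqP; rewrite mulf_eq0 signr_eq0 /= addrC addr_eq0.
  by move/eqP.
have neq_s : p ++ [set a] :: [set b] :: q != p ++ [set b] :: [set a] :: q.
  by rewrite eqseq_cat // eqxx /= eqseq_cons negb_and (inj_eq set1_inj) neq_ab.
move=> c; have tc := top_cell c; have sz_c := size_top tc.
have mE : (p ++ ([set a] :|: [set b]) :: q == merge_ends (tval (val c))) = false.
  apply/eqP=> eq_m; case/eqP: p0.
  case: (@merge_ends_singletons _ k k_gt2 p a b q _ ts tc) => //.
  by rewrite sz_c; lia.
rewrite /incidence mE mulr0 addr0.
have [] := boolP (p ++ ([set a] :|: [set b]) :: q ==
                  merge_at (size p) (tval (val c))).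
  move=> eq_m.
  have lt_pc : ((size p).+1 < size (tval (val c)))%N by rewrite sz_c ltnS.
  rewrite (bigD1 (Ordinal sz_p)) //= eq_m mulr1 big1 ?addr0; last first.
    move=> i neq_i; case: eqP => [eq_i|_]; last by rewrite mulr0.
    case: (@merge_at_singletons _ k k_gt2 p a b q (tval (val c)) i ts tc) => //.
      by rewrite sz_c ltnS.
    by move=> def_i; case/eqP: neq_i; apply: val_inj.
  rewrite -expr2 sqrr_sign.
  case: (@merge_at_singletons _ k k_gt2 p a b q _ _ ts tc lt_pc).
    exact/esym/eqP.
  move=> _ [->|->]; rewrite eqxx ?(negPf neq_s) ?mul1r ?addr0 //.
  by rewrite eq_sym (negPf neq_s) add0r.
move=> neq_m; rewrite big1 ?mulr0 => [|i _]; last first.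
  case: eqP => [eq_i|_]; last by rewrite mulr0.
  case: (@merge_at_singletons _ k k_gt2 p a b q (tval (val c)) i ts tc) => //.
    by rewrite sz_c ltnS.
  by move=> def_i; case/eqP: neq_m; rewrite -def_i.
have [def_c|_] := eqVneq (tval (val c)) (p ++ [set a] :: [set b] :: q).
  by rewrite def_c merge_at_cat eqxx in neq_m.
have [def_c|_] := eqVneq (tval (val c)) (p ++ [set b] :: [set a] :: q).
  by rewrite def_c merge_at_cat setUC eqxx in neq_m.
by rewrite !mulr0 addr0.
Qed.

(** The face with the pair in front arises from the first merge, with sign 1, and from merging the
    ends, with sign [(-1) ^+ m]. *)
Lemma coef_rot (a b : 'I_n) q : top ([set a] :: [set b] :: q) ->
  coef f ([set a] :: rcons q [set b]) =
  - (-1) ^+ m * coef f ([set a] :: [set b] :: q).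
Proof.
move=> ts; have sz_s := size_top ts; have ops := top_ordered_partition ts.
case/andP: (ts) => ns _.
have nt := @normal_class_merge _ _ [::] _ _ _ ns.
have st : size (([set a] :|: [set b]) :: q) == m.
  by move: sz_s => /= -[<-].
have neq_ab : a != b := @neq_adjacent _ [::] _ _ _ ops.
have m_gt0 : (0 < m)%N by rewrite -(eqP st).
(* The candidates with the two singletons exchanged start with [[set b]] and are not normal forms,
   since [a] is the vertex of value 0. *)
have no_swap (c : cell H m.+1) r : perm_eq r ([set a] :: q) ->
    tval (val c) = [set b] :: r -> False.
  move=> eq_r def_c; have := top_cell c; rewrite def_c => tc.
  case/eqP: neq_ab; apply: top_head_inj ts tc.
  rewrite perm_sym -(perm_cons [set b]) in eq_r; apply: perm_trans eq_r.
  exact/permPl/(perm_catCA [:: [set a]] [:: [set b]] q).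
have := sum_incidence0 nt st.
rewrite (@sum_coef2 _ _ _ _ f (incidence F m _) ((-1) ^+ m)
   ([set a] :: [set b] :: q) ([set a] :: rcons q [set b])).
  move/eqP; rewrite addr_eq0 => /eqP->.
  by rewrite mulrN mulNr opprK mulrA -expr2 sqrr_sign mul1r.
move=> c; have tc := top_cell c; have sz_c := size_top tc.
have mE i : (i < m)%N ->
    (([set a] :|: [set b]) :: q == merge_at i (tval (val c))) =
    (i == 0)%N && (tval (val c) == [set a] :: [set b] :: q).
  move=> lt_im; apply/eqP/andP=> [eq_i | [/eqP-> /eqP->]]; last first.
    by rewrite (@merge_at_cat _ [::]).
  case: (@merge_at_singletons _ k k_gt2 [::] a b q (tval (val c)) i ts tc) => //.
    by rewrite sz_c ltnS.
  by move=> -> [->//|/no_swap[]].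
rewrite /incidence; congr (_ + _ * (nat_of_bool _)%:R).
  rewrite (bigD1 (Ordinal m_gt0)) //= mE // eqxx mul1r big1 ?addr0 // => i.
  by rewrite -val_eqE /= => i0; rewrite mE // (negPf i0) mulr0.
apply/eqP/eqP=> [eq_m | ->]; last by rewrite merge_ends_rcons.
case: (@merge_ends_singletons _ k k_gt2 [::] a b q (tval (val c)) ts tc) => //.
  by rewrite sz_c ltnS.
by move=> _ [->//|/no_swap[]]; rewrite perm_rcons.
Qed.

Definition inversion_sign s : F := (-1) ^+ odd_inversions s.

(** The inversion sign turns the antisymmetry of a cycle into invariance. *)
Definition signed_coef s : F := inversion_sign s * coef f s.

Lemma signed_coef_swap p x y q : p != [::] -> #|x| = 1%N -> #|y| = 1%N ->
    top (p ++ x :: y :: q) ->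
  signed_coef (p ++ y :: x :: q) = signed_coef (p ++ x :: y :: q).
Proof.
move=> p0 /eqP/cards1P[a ->] /eqP/cards1P[b ->] ts.
have neq_ab := neq_adjacent (top_ordered_partition ts).
rewrite /signed_coef /inversion_sign coef_swap // odd_inversions_swap.
  by rewrite signrN mulrNN.
by rewrite (inj_eq set1_inj).
Qed.

Lemma signed_coef_rot x y q : #|x| = 1%N -> #|y| = 1%N -> top (x :: y :: q) ->
  signed_coef (x :: rcons q y) = signed_coef (x :: y :: q).
Proof.
move=> /eqP/cards1P[a ->] /eqP/cards1P[b ->] ts.
have := top_ordered_partition ts => /andP[/and3P[_ qb _] _].
have [def_m] : (size q).+2 = m.+1 := size_top ts.
rewrite /signed_coef /inversion_sign coef_rot //.
rewrite (@odd_inversions_rcons _ [:: [set a]]) // signr_addb signr_odd.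
(* As [m] is [size q] plus one, the sign from [coef_rot] is the one caused by moving [y] past
   [q]. *)
have -> : - (-1) ^+ m = (-1) ^+ size q :> F.
  by rewrite -def_m exprS mulN1r opprK.
by rewrite [LHS]mulrACA -expr2 sqrr_sign mul1r.
Qed.

Lemma signed_coef_bubble p w x q : p != [::] -> {in x :: w, forall y, #|y| = 1%N} ->
    top (p ++ x :: w ++ q) ->
  signed_coef (p ++ w ++ x :: q) = signed_coef (p ++ x :: w ++ q).
Proof.
elim: w p => [|y w IHw] p //= p0 c1 ts.
have cx : #|x| = 1%N by apply: c1; rewrite mem_head.
have cy : #|y| = 1%N by apply: c1; rewrite !inE eqxx orbT.
have p1 : rcons p y != [::] by rewrite -size_eq0 size_rcons.
have eq_s := signed_coef_swap p0 cx cy ts.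
rewrite -eq_s -!(cat_rcons y p) IHw // => [z|].
  by rewrite inE => /predU1P[->//|zw]; apply: c1; rewrite !inE zw !orbT.
rewrite cat_rcons; case: p p0 ts {IHw p1 eq_s} => //= z p _; apply: top_perm.
by rewrite perm_cat2l; apply/permPl/(perm_catCA [:: x] [:: y]).
Qed.

(** Bubble the first entry of [w] from its place in [w'] to the front, absorb it into the prefix and
    recurse. The prefix may contain the block of size [k]. *)
Lemma signed_coef_perm p w w' : p != [::] -> {in w, forall y, #|y| = 1%N} ->
  perm_eq w w' -> top (p ++ w) -> signed_coef (p ++ w) = signed_coef (p ++ w').
Proof.
elim: w p w' => [|x w IHw] p w' p0 c1.
  by rewrite perm_sym => /perm_nilP->.
move=> eqw ts; have w'x : x \in w' by rewrite -(perm_mem eqw) mem_head.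
case/splitPr: w'x eqw => w1 w2 eqw.
have eq_w : perm_eq w (w1 ++ w2).
  rewrite -(perm_cons x); apply: perm_trans eqw _.
  exact/permPl/(perm_catCA w1 [:: x] w2).
have p1 : rcons p x != [::] by rewrite -size_eq0 size_rcons.
rewrite signed_coef_bubble // => [|z|]; first last.
- case: p p0 ts {IHw p1} => //= z p _; apply: top_perm.
  by rewrite perm_cat2l perm_cons.
- rewrite inE => /predU1P[->|zw1]; apply: c1; rewrite inE ?eqxx //.
  by rewrite (perm_mem eq_w) mem_cat zw1 orbT.
rewrite -!cat_rcons; apply: IHw; rewrite ?cat_rcons // => z zw.
by apply: c1; rewrite inE zw orbT.
Qed.

(** Swaps involve only singletons and cannot cross [A]. Instead, each singleton between [B] and [A]
    goes around to the end by [signed_coef_rot]. *)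
Lemma signed_coef_rotate B w A v : #|B| = 1%N -> {in w, forall y, #|y| = 1%N} ->
    top (B :: w ++ A :: v) ->
  signed_coef (B :: w ++ A :: v) = signed_coef (B :: A :: v ++ w).
Proof.
move=> cB; elim: w v => [|x w IHw] v c1 ts; first by rewrite cats0.
have cx : #|x| = 1%N by apply: c1; rewrite mem_head.
rewrite /= -signed_coef_rot // rcons_cat rcons_cons IHw ?cat_rcons //.
  by move=> z zw; apply: c1; rewrite inE zw orbT.
rewrite -rcons_cons -rcons_cat; apply: top_perm ts.
by rewrite perm_sym perm_rcons.
Qed.

Lemma signed_coef_perm_eq s s' : perm_eq s s' -> top s -> top s' ->
  signed_coef s = signed_coef s'.
Proof.
move=> eqs ts ts'; have [ns _] := andP ts; have [ns' _] := andP ts'.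
have := head_normal_class_inj eqs ns ns'.
case: s eqs ts {ns} => [|B r] eqs ts; first by have := size_top ts.
case: s' eqs ts' {ns'} => [|B' r'] eqs ts'; first by have := size_top ts'.
move=> /= eqB; rewrite -{B'}eqB perm_cons in eqs ts' *.
case: (topP ts) => [[|C s1] [A [s2 [[eqB def_r] cA c1]]]].
  (* Here the head is the block of size [k], and the tail consists of singletons. Otherwise both
     lists are rotated until that block is second, and the singletons after it are permuted. *)
  by rewrite {r}def_r in eqs ts *; apply: (@signed_coef_perm [:: B]).
rewrite -{C}eqB {r}def_r in eqs ts c1 *.
have cB : #|B| = 1%N by apply: c1; rewrite mem_head.
have r'A : A \in r' by rewrite -(perm_mem eqs) mem_cat mem_head orbT.
case/splitPr: r'A eqs ts' => t1 t2 eqs ts'.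
have c_s : {in s2 ++ s1, forall y, #|y| = 1%N}.
  move=> y; rewrite mem_cat => /orP[] sy; apply: c1;
  by rewrite mem_cat inE sy !orbT.
have eq_st : perm_eq (s2 ++ s1) (t2 ++ t1).
  move: eqs; rewrite -!cat_rcons -!cats1 -!catA.
  move/permPl => e; rewrite -(perm_cat2l [:: A]).
  have e1 := perm_catC s1 ([:: A] ++ s2); have e2 := perm_catC t1 ([:: A] ++ t2).
  by rewrite -!catA in e1 e2; rewrite -e1 e e2.
have c_t : {in t2 ++ t1, forall y, #|y| = 1%N}.
  by move=> y ty; apply: c_s; rewrite (perm_mem eq_st).
rewrite !signed_coef_rotate //; last 2 first.
- by move=> y ty; apply: c_t; rewrite mem_cat ty orbT.
- by move=> y sy; apply: c_s; rewrite mem_cat sy orbT.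
apply: (@signed_coef_perm [:: B; A]) => //.
apply: top_perm ts; exact/permPl/(perm_catC s1 (A :: s2)).
Qed.

End Moves.

(** * Cycles built from scalars on the [k]-subsets *)

Definition kset := {A : {set 'I_n} | #|A| == k}.

(** Summing over all blocks of size [k] avoids selecting one; on a top class the sum has a single
    term. *)
Definition cycle_coef (g : {ffun kset -> F^o}) s : F :=
  inversion_sign s * \sum_(A : kset | val A \in s) g A.

Definition cycle_fun (g : {ffun kset -> F^o}) : chain F H m.+1 :=
  [ffun c : cell H m.+1 => cycle_coef g (tval (val c))].

Fact cycle_fun_is_linear : linear cycle_fun.
Proof.
move=> a g h; apply/ffunP=> c; rewrite !ffunE /cycle_coef.
rewrite scalerAr -mulrDr; congr (_ * _); rewrite scaler_sumr -big_split /=.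
by apply: eq_bigr => A _; rewrite !ffunE.
Qed.

HB.instance Definition _ :=
  GRing.isLinear.Build F {ffun kset -> F^o} (chain F H m.+1) *:%R cycle_fun
    cycle_fun_is_linear.

(* Exchanging blocks i and i + 1 preserves the i-th face and reverses the sign,
   so the contributions of the faces with 0 < i cancel; the 0-th face and the
   last one cancel each other through rotate_tail. *)
Definition swap_at i s :=
  take i s ++ nth set0 s i.+1 :: nth set0 s i :: drop i.+2 s.

Lemma swap_at_cat p x y q :
  swap_at (size p) (p ++ x :: y :: q) = p ++ y :: x :: q.
Proof.
rewrite /swap_at take_size_cat // !nth_cat ltnn subnn ltnNge leqnSn /=.
by rewrite subSnn drop_cat ltnNge -addn2 leq_addr /= addKn /= drop0.
Qed.

Definition rotate_tail s := if s is x :: s' then x :: rot 1 s' else [::].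

Lemma cycle_coef_swap (g : {ffun kset -> F^o}) p x y q : x != y ->
  cycle_coef g (p ++ y :: x :: q) = - cycle_coef g (p ++ x :: y :: q).
Proof.
move=> neq_xy; rewrite /cycle_coef /inversion_sign odd_inversions_swap //.
rewrite signrN mulNr; congr (- (_ * _)); apply: eq_bigl => A.
by rewrite !mem_cat !inE (orbCA (_ == y)).
Qed.

Lemma cycle_coef_rot (g : {ffun kset -> F^o}) x y q : y \notin q ->
  cycle_coef g (x :: rcons q y) = (-1) ^+ size q * cycle_coef g (x :: y :: q).
Proof.
move=> qy; rewrite /cycle_coef /inversion_sign.
rewrite (@odd_inversions_rcons _ [:: x]) // signr_addb signr_odd -mulrA.
by congr (_ * (_ * _)); apply: eq_bigl => A; rewrite !inE mem_rcons inE.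
Qed.

Hypothesis charF0 : [pchar F] =i pred0.

Lemma eq_opp_eq0 (a : F) : a = - a -> a = 0.
Proof.
move=> eq_a; have /eqP : a *+ 2 = 0 by rewrite mulr2n {1}eq_a addNr.
by rewrite -mulr_natr mulf_eq0 ((pcharf0P F).1 charF0) orbF => /eqP.
Qed.

Lemma boundary_cycle (g : {ffun kset -> F^o}) :
  boundary_fun (cycle_fun g) = 0.
Proof.
apply/ffunP=> t; rewrite ffunE boundary_funE.
have m_gt0 : (0 < m)%N.
  have /and3P[_ hs _] := valP t.
  by rewrite -(size_tuple (val t)); case: (tval _) hs.
set tt := tval (val t).
under eq_bigr => c _ do rewrite ffunE /incidence mulrDr mulr_sumr.
rewrite big_split exchange_big /= (bigD1 (Ordinal m_gt0)) //=.
rewrite [X in _ + X + _]big1 ?addr0 => [|i i0].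
  (* After reindexing by [rotate_tail], the ends being merged are the first two blocks of the
     original list. The rotation sign times [(-1) ^+ m] is -1, so this sum cancels the 0-th
     faces. *)
  pose K s := cycle_coef g s * ((-1) ^+ m * (tt == merge_ends s)%:R).
  rewrite -(@sum_cell_reindex _ _ H _ rotate_tail K) /=; first last.
  - move=> c c'; have := size_tuple (val c); have := size_tuple (val c').
    case: (tval (val c)) => [|x s] //= _; case: (tval (val c')) => //= x' s' _.
    by case=> -> /rot_inj->.
  - move=> c; rewrite -[X in _ == X](size_tuple (val c)).
    by case: (tval _) => //= x s; rewrite size_rot.
  - move=> c; have := valP c; case: (tval (val c)) => //= x s.
    by apply: normal_class_perm; rewrite perm_sym perm_rot.
  rewrite -big_split big1 //= => c _; rewrite /K.
  have /and3P[/andP[+ _] _ _] := valP c; have := size_tuple (val c).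
  case: (tval (val c)) => [|x [|y q]] //=.
    by case=> m0; rewrite -m0 in m_gt0.
  case=> def_m /and3P[_ qy _]; rewrite rot1_cons merge_ends_rcons cycle_coef_rot //.
  rewrite (@merge_at_cat _ [::]) mul1r -[in (-1) ^+ m]def_m exprS mulN1r.
  rewrite mulNr mulrN.
  by rewrite mulrCA !mulrA -expr2 sqrr_sign mul1r subrr.
rewrite -val_eqE /= in i0.
pose K s := cycle_coef g s * ((-1) ^+ i * (tt == merge_at i s)%:R).
(* For positive [i] the head [z] is not exchanged, which keeps the list a normal form; [x] and [y]
   differ because blocks do not repeat. *)
have split_c (c : cell H m.+1) : exists z p x y q,
    [/\ tval (val c) = (z :: p) ++ x :: y :: q, i = (size p).+1 :> nat & x != y].
  have [] := @cat_adjacent _ i (tval (val c)); first by rewrite size_tuple ltnS.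
  case=> [|z p] [x [y [q [def_c def_i]]]]; first by rewrite -def_i in i0.
  exists z, p, x, y, q; split=> //.
  have /and3P[/andP[+ _] _ _] := valP c; rewrite def_c cat_uniq.
  by case/and3P=> _ _ /andP[+ _]; rewrite inE negb_or => /andP[].
(* The swap keeps the merged face and negates the coefficient, so the sum equals its opposite and
   vanishes in characteristic zero. *)
apply: eq_opp_eq0; rewrite -{1}(@sum_cell_reindex _ _ H _ (swap_at i) K).
- rewrite -sumrN; apply: eq_bigr => c _; rewrite /K.
  have [z [p [x [y [q [-> -> neq_xy]]]]]] := split_c c.
  rewrite (swap_at_cat (z :: p)) !(merge_at_cat (z :: p)) cycle_coef_swap //.
  by rewrite mulNr setUC.
- move=> c; have [z [p [x [y [q [def_c -> neq_xy]]]]]] := split_c c.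
  have := valP c; rewrite def_c (swap_at_cat (z :: p)); apply: normal_class_perm.
  by rewrite perm_cat2l; apply/permPl/(perm_catCA [:: x] [:: y]).
- move=> c; have [z [p [x [y [q [def_c -> neq_xy]]]]]] := split_c c.
  have := size_tuple (val c); rewrite def_c (swap_at_cat (z :: p)) => <-.
  by rewrite !size_cat.
- have swapK (c : cell H m.+1) :
      swap_at i (swap_at i (tval (val c))) = tval (val c).
    have [z [p [x [y [q [-> -> neq_xy]]]]]] := split_c c.
    by rewrite !(swap_at_cat (z :: p)).
  by move=> c c' eq_c; rewrite -(swapK c) eq_c swapK.
Qed.

(** * Dimension of the kernel and of the homology *)

Lemma cycle_coef_mem (g : {ffun kset -> F^o}) (A : kset) s :
  top s -> val A \in s -> cycle_coef g s = inversion_sign s * g A.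
Proof.
move=> ts sA; congr (_ * _); rewrite (big_pred1 A) // => B.
apply/idP/eqP=> [sB | -> //]; apply: val_inj.
(* The blocks other than [D] are singletons, hence too small to have [k] elements. *)
have uniq_k (C : kset) s1 D s2 : s = s1 ++ D :: s2 ->
    {in s1 ++ s2, forall E : {set 'I_n}, #|E| = 1%N} -> val C \in s -> val C = D.
  move=> -> c1; rewrite mem_cat inE orbCA -mem_cat => /predU1P[//|/c1].
  by rewrite (eqP (valP C)) => k1; have := k_gt2; lia.
have [s1 [D [s2 [def_s _ c1]]]] := topP ts.
by rewrite (uniq_k _ _ _ _ def_s c1 sB) (uniq_k _ _ _ _ def_s c1 sA).
Qed.

Lemma cycle_fun_inj : injective cycle_fun.
Proof.
move=> g h eq_gh; apply/ffunP=> A.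
have [|s ts sA] := exists_top _ (eqP (valP A)); first by lia.
have [ns _] := andP ts; have /eqP sz := size_top ts.
have := congr1 (fun f : chain F H m.+1 => f (mkcell ns sz)) eq_gh.
rewrite !ffunE /= !(cycle_coef_mem _ ts sA).
by apply: mulfI; rewrite signr_eq0.
Qed.

(** The scalar of [A] is the signed coefficient at some chosen top class containing [A]; by
    [signed_coef_perm_eq] any other such class gives the same value. *)
Lemma ker_boundary_cycle f : boundary_fun f = 0 -> exists g, f = cycle_fun g.
Proof.
move=> f_ker; pose ts (A : kset) := exists_top (ltnW (ltnW k_gt2)) (eqP (valP A)).
exists [ffun A => signed_coef f (s2val (sig2W (ts A)))].
apply/ffunP=> c; rewrite ffunE; have tc := top_cell c.
have [s1 [D [s2 [def_c /eqP cD _]]]] := topP tc.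
pose A : kset := exist _ D cD.
have cA : val A \in tval (val c) by rewrite def_c mem_cat mem_head orbT.
rewrite (cycle_coef_mem _ tc cA) ffunE; case: sig2W => s /= tA sA.
rewrite (@signed_coef_perm_eq _ f_ker s (tval (val c))) //.
  by rewrite /signed_coef mulrA -expr2 sqrr_sign mul1r coef_cell.
exact: (top_perm_eq (ltnW k_gt2) (eqP cD)).
Qed.

Lemma dim_ker_boundary : \dim (lker (boundary F H m)) = 'C(n, k).
Proof.
have -> : lker (boundary F H m) = limg (linfun cycle_fun).
  apply/vspaceP=> f; rewrite memv_ker lfunE /=; apply/eqP/memv_imgP.
    by case/ker_boundary_cycle=> g ->; exists g; rewrite ?memvf // lfunE.
  by case=> g _ ->; rewrite lfunE; apply: boundary_cycle.
rewrite limg_dim_eq; last first.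
  rewrite capfv; apply/eqP/lker0P=> g h; rewrite !lfunE; exact: cycle_fun_inj.
rewrite dimvf /dim /= muln1 card_sig.
have := card_draws 'I_n k; rewrite card_ord => <-.
by apply: eq_card => A; rewrite !inE.
Qed.

(** The source is the zero space: by [size_normal_class] no class has [m.+2] blocks. *)
Lemma limg_boundary_top : limg (boundary F H m.+1) = 0%VS.
Proof.
apply/eqP; rewrite -subv0; apply/subvP=> f /memv_imgP[g _ ->].
suff -> : g = 0 by rewrite linear0 mem0v.
apply/ffunP=> c; have := size_normal_class (valP c).
by rewrite size_tuple; have := def_n; lia.
Qed.

End Kernel.

Theorem theorem3p4 (F : fieldType) (charF0 : [pchar F] =i pred0)
    (n k : nat) (k_ge3 : (2 < k)%N) (le_kn : (k <= n)%N) :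
  dimHC F (complete_uniform n k) (n%:Z - k%:Z - 1) = 'C(n, n - k)%N.
Proof.
(* Degree [n - k - 1] corresponds to [m = n - k], that is, to classes with [n - k + 1] blocks. *)
rewrite /dimHC subrK subzn // bin_sub //.
have def_n : n = (n - k + k)%N by rewrite subnK.
rewrite -(dim_ker_boundary k_ge3 def_n charF0) /homology.
(* The complement of a zero image in the kernel has the dimension of the kernel. *)
have := dimv_cap_compl (lker (boundary F (complete_uniform n k) (n - k)))
  (limg (boundary F (complete_uniform n k) (n - k).+1)).
by rewrite limg_boundary_top // capv0 dimv0 add0n.
Qed.
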